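(* Let $e\geq 3$ be an integer and let $J(2e+1,e)$ be the Johnson graph. Then $\mu(J(2e+1,e))\leq 2e$.
   Context: For a connected graph $\Gamma$ with distance function $d$, a resolving set is a set of vertices $S=\{v_1,\ldots,v_k\}$ such that for any two distinct vertices $u,v$ the vectors $(d(u,v_1),\ldots,d(u,v_k))$ and $(d(v,v_1),\ldots,d(v,v_k))$ differ. The metric dimension $\mu(\Gamma)$ is the smallest size of a resolving set of $\Gamma$. For integers $2\le 2e\le n$, the Johnson graph $J(n,e)$ has as vertices the $e$-element subsets of $\{1,\ldots,n\}$, two vertices $P,Q$ being adjacent iff $|P\cap Q|=e-1$. *)

(* Defs.v *)
From mathcomp Require Import all_boot.

Set Implicit Arguments.
Unset Strict Implicit.
Unset Printing Implicit Defensive.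

Section Graph.

Variables (T : finType) (r : rel T).

Definition walk (k : nat) (x y : T) : bool :=
  [exists p : k.-tuple T, path r x p && (last x p == y)].

(* The least length of a walk from x to y. A shortest walk has no repeated
   vertex, so lengths below #|T| suffice; the value is #|T| when x and y are
   not connected. *)
Definition dist (x y : T) : nat := find (fun k => walk k x y) (iota 0 #|T|).

(* The sequence lists the distances from u to the vertices of S in the order
   of enum S. *)
Definition resolving (S : {set T}) : bool :=
  [forall u, forall v, (u != v) ==>
     ([seq dist u w | w in S] != [seq dist v w | w in S])].

(* The whole vertex set is resolving (resolving_setT below), so the minimum is
   over a nonempty family. *)
Definition metric_dim : nat := #|[arg min_(S < setT | resolving S) #|S|]|.

Lemma walkP k x y :
  reflect (exists p, [/\ size p = k, path r x p & last x p = y]) (walk k x y).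
Proof.
apply: (iffP existsP) => [[p /andP[rp /eqP lp]]|[p [sp rp lp]]].
  by exists p; rewrite size_tuple.
have sp' : size p == k by apply/eqP.
by exists (Tuple sp'); rewrite /= rp lp eqxx.
Qed.

Lemma dist_le k x y : walk k x y -> dist x y <= k.
Proof.
move=> wk; have [ltkT|leTk] := ltnP k #|T|; last first.
  by apply: leq_trans leTk; rewrite (leq_trans (find_size _ _)) ?size_iota.
rewrite leqNgt; apply/negP => /(before_find 0).
by rewrite nth_iota // add0n wk.
Qed.

Lemma walk_dist x y : connect r x y -> walk (dist x y) x y.
Proof.
case/connectP => p rp ->; case/shortenP: rp => p' rp' up' _.
have ltp : size p' < #|T| by rewrite -[(size p').+1]/(size (x :: p')) -(card_uniqP up') max_card.
have hw : has (fun k => walk k x (last x p')) (iota 0 #|T|).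
  apply/hasP; exists (size p'); first by rewrite mem_iota.
  by apply/walkP; exists p'.
by have := nth_find 0 hw; rewrite nth_iota // -[X in _ < X](size_iota 0) -has_find.
Qed.

Lemma dist_eq0 x y : (dist x y == 0) = (x == y).
Proof.
apply/idP/eqP => [/eqP d0|->]; last first.
  by rewrite -leqn0 dist_le //; apply/walkP; exists [::].
have T0 : 0 < #|T| by apply/card_gt0P; exists x.
have : has (fun k => walk k x y) (iota 0 #|T|) by rewrite has_find size_iota -/(dist x y) d0.
move/(nth_find 0); rewrite -/(dist x y) d0 nth_iota //.
by case/walkP => p [/size0nil -> _ /=].
Qed.

Lemma resolvingP (S : {set T}) :
  reflect (forall u v, u != v -> exists2 w, w \in S & dist u w != dist v w)
          (resolving S).
Proof.
apply: (iffP forallP) => [rS u v neq|rS u].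
  have /forallP/(_ v)/implyP/(_ neq) := rS u.
  have [/exists_inP//|/exists_inPn nw] := boolP [exists w in S, dist u w != dist v w].
  case/eqP; apply/eq_in_map => w; rewrite mem_enum => /nw.
  by rewrite negbK => /eqP.
apply/forallP => v; apply/implyP => /rS[w wS]; apply: contraNN => /eqP.
by move/eq_in_map/(_ w) => ->//; rewrite mem_enum.
Qed.

Lemma resolving_setT : resolving setT.
Proof.
apply/resolvingP => u v; exists u => //.
have /eqP-> : dist u u == 0 by rewrite dist_eq0.
by rewrite eq_sym dist_eq0 eq_sym.
Qed.

Lemma metric_dimP :
  (exists2 S : {set T}, resolving S & #|S| = metric_dim) /\
  (forall S : {set T}, resolving S -> metric_dim <= #|S|).
Proof.
rewrite /metric_dim; case: arg_minnP => [|S rS minS]; first exact: resolving_setT.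
by split=> //; exists S.
Qed.

End Graph.

Definition johnson_vertex (n e : nat) := {P : {set 'I_n} | #|P| == e}.

(* Adjacency is #|P :&: Q| = e - 1, written without truncated subtraction. *)
Definition johnson (n e : nat) : rel (johnson_vertex n e) :=
  fun P Q => #|val P :&: val Q|.+1 == e.

Lemma johnson_sym n e : symmetric (@johnson n e).
Proof. by move=> P Q; rewrite /johnson setIC. Qed.

Lemma johnson_irr n e : irreflexive (@johnson n e).
Proof.
by move=> P; rewrite /johnson setIid (eqP (valP P)) eqn_leq ltnn.
Qed.

Lemma johnson_connected n e (P Q : johnson_vertex n e) :
  connect (@johnson n e) P Q.
Proof.
have [m] := ubnP #|val P :\: val Q|; elim: m P => // m IH P ltm.
have cP := eqP (valP P); have cQ := eqP (valP Q).
have eqD : #|val Q :\: val P| = #|val P :\: val Q|.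
  by apply/eqP; rewrite -(eqn_add2l #|val P :&: val Q|) cardsID {1}setIC cardsID cP cQ.
have [PQ0|[a aPQ]] := set_0Vmem (val P :\: val Q).
  suff -> : P = Q by exact: connect0.
  apply/val_inj/eqP; rewrite eqEcard cP cQ leqnn andbT.
  by rewrite -setD_eq0 PQ0.
have [b bQP] : exists b, b \in val Q :\: val P.
  by apply/card_gt0P; rewrite eqD; apply/card_gt0P; exists a.
move: (aPQ) (bQP); rewrite !inE => /andP[aQ aP] /andP[bP bQ].
have cPa : #|val P :\ a|.+1 = e by move: cP; rewrite (cardsD1 a) aP.
have cR : #|b |: (val P :\ a)| == e.
  by rewrite cardsU1 !inE (negPf bP) andbF add1n cPa.
pose R : johnson_vertex n e := Sub (b |: (val P :\ a)) cR.
apply: (@connect_trans _ _ R); last first.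
  apply: IH; apply: leq_trans (ltm : _ <= m); apply: proper_card.
  apply/properP; split.
    apply/subsetP=> z; rewrite !inE /= => /andP[zQ /orP[/eqP zb|/andP[_ ->]]].
      by rewrite zb bQ in zQ.
    by rewrite zQ.
  exists a => //; rewrite !inE eqxx /= orbF negb_and negbK.
  by apply/orP; right; apply: contraNneq bP => <-.
apply: connect1; rewrite /johnson /=.
have -> : val P :&: (b |: (val P :\ a)) = val P :\ a.
  apply/setP=> z; rewrite !inE; have [->|] := eqVneq z b.
    by rewrite (negPf bP) andbF.
  by case: (z \in val P); rewrite ?andbF ?andbT.
by rewrite cPa.
Qed.

(* Main.v *)
Require Import Defs.
From mathcomp Require Import all_boot.
From mathcomp Require Import ssralg zmodp.

(** Identify the [2e+1] points with the integers modulo [2e+1]; the resolving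
    set consists of the cyclic intervals [I_i = {i, ..., i+e-1}] with the one at
    [i = 0] left out.  Since [d(P,Q) = e - |P :&: Q|], two vertices [P], [Q] with
    equal distances to these meet every [I_i], [i <> 0], in equally many points;
    as every point lies in exactly [e] of the [2e+1] intervals, this extends to
    [i = 0].  Comparing [I_i] with [I_(i+1)] shows that the difference of the
    indicator functions of [P] and [Q] is invariant under translation by [e],
    hence by [2e = -1], hence is constant; so [P = Q] because [|P| = |Q|]. *)

Set Implicit Arguments.
Unset Strict Implicit.
Unset Printing Implicit Defensive.

Import GRing.Theory.

Section JohnsonDistance.

Variables n e : nat.
Implicit Types P Q : johnson_vertex n e.

Lemma johnson_cardID P Q : #|val P :&: val Q| + #|val P :\: val Q| = e.
Proof. by rewrite cardsID (eqP (valP P)). Qed.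

Lemma johnson_cardD P Q : johnson P Q = (#|val P :\: val Q| == 1).
Proof.
have E := johnson_cardID P Q.
by rewrite /johnson -[X in _ == X]E -addn1 eqn_add2l eq_sym.
Qed.

(** Triangle inequality along the walk: [P :\: Q] lies in the union of [P :\: R] and [R :\: Q], and
    the first of these is a singleton when [R] is a neighbour of [P]. *)
Lemma johnson_walk_ge k P Q : walk (@johnson n e) k P Q -> #|val P :\: val Q| <= k.
Proof.
case/walkP => p [<- rp <-] {k Q}; elim: p P rp => [|R p IH] P /=.
  by rewrite setDv cards0.
case/andP; rewrite johnson_cardD => /eqP PR1 /IH leR.
rewrite -add1n -PR1; apply: leq_trans (leq_add (leqnn _) leR).
apply: leq_trans (leq_card_setU _ _); apply/subset_leq_card/subsetP => z.
by rewrite !inE => /andP[-> ->]; case: (z \in val R).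
Qed.

(** Swapping some [a] in [P :\: Q] for some [b] in [Q :\: P] is one step of the graph and removes
    exactly [a] from the difference. *)
Lemma johnson_walk P Q : walk (@johnson n e) #|val P :\: val Q| P Q.
Proof.
move dP: #|val P :\: val Q| => d; elim: d P dP => [|d IH] P dP.
  apply/walkP; exists [::]; split=> //=; apply/val_inj/eqP.
  by rewrite eqEcard (eqP (valP P)) (eqP (valP Q)) leqnn andbT -setD_eq0 -cards_eq0 dP.
have /card_gt0P[a aPQ] : 0 < #|val P :\: val Q| by rewrite dP.
have /card_gt0P[b bQP] : 0 < #|val Q :\: val P|.
  suff -> : #|val Q :\: val P| = #|val P :\: val Q| by rewrite dP.
  apply/eqP; rewrite -(eqn_add2l #|val Q :&: val P|) johnson_cardID setIC.
  by rewrite johnson_cardID.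
move: (aPQ) (bQP); rewrite !inE => /andP[aQ aP] /andP[bP bQ].
have cPa : #|val P :\ a|.+1 = e.
  by have := eqP (valP P); rewrite (cardsD1 a) aP.
have cR : #|b |: (val P :\ a)| == e.
  by rewrite cardsU1 !inE (negPf bP) andbF add1n cPa.
pose R : johnson_vertex n e := Sub (b |: (val P :\ a)) cR.
have /IH/walkP[p [sp rp lp]] : #|val R :\: val Q| = d.
  have -> : val R :\: val Q = (val P :\: val Q) :\ a.
    apply/setP => z; rewrite !inE; have [->|_] := eqVneq z b.
      by rewrite bQ andbF.
    by rewrite andbCA.
  by move: dP; rewrite (cardsD1 a) aPQ add1n => -[].
apply/walkP; exists (R :: p); split=> //=; first by rewrite sp.
rewrite rp andbT johnson_cardD.
have -> : val P :\: val R = [set a]; last by rewrite cards1.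
apply/setP => z; rewrite !inE; have [->|zb] /= := eqVneq z b.
  by apply/esym/negbTE; apply: contraNneq bP => ->.
by have [->|_] := eqVneq z a; rewrite ?aP //=; case: (z \in val P).
Qed.

Lemma johnson_dist P Q : dist (@johnson n e) P Q = #|val P :\: val Q|.
Proof.
apply/eqP; rewrite eqn_leq (dist_le (johnson_walk P Q)) /=.
exact/johnson_walk_ge/walk_dist/johnson_connected.
Qed.

Lemma johnson_dist_cap P Q R :
  dist (@johnson n e) P R = dist (@johnson n e) Q R ->
  #|val P :&: val R| = #|val Q :&: val R|.
Proof.
rewrite !johnson_dist => eqD.
by apply: (@addIn #|val P :\: val R|); rewrite {2}eqD !johnson_cardID.
Qed.

End JohnsonDistance.

Section CyclicInterval.

Variables m e : nat.
Hypothesis lt_em : e < m.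
Implicit Types (i j : 'I_m.+1) (A B : {set 'I_m.+1}).

(** The subtraction is modulo [m.+1] and its result is compared as a natural number in [0..m], so
    the interval wraps around. *)
Definition cyclic_interval i : {set 'I_m.+1} := [set j : 'I_m.+1 | (j - i)%R < e].

Lemma card_ord_lt : #|[set k : 'I_m.+1 | k < e]| = e.
Proof.
rewrite -sum1dep_card -(big_ord_widen _ (fun _ => 1)); last by rewrite ltnW // ltnW.
by rewrite sum1_card card_ord.
Qed.

Lemma card_cyclic_interval i : #|cyclic_interval i| = e.
Proof.
rewrite -[RHS]card_ord_lt -[LHS](card_imset _ (addIr (- i)%R)).
apply: eq_card => k; rewrite [RHS]inE; apply/imsetP/idP => [[j]|ltk].
  by rewrite inE => ltj ->.
by exists (k + i)%R; rewrite ?inE addrK.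
Qed.

Lemma card_cyclic_interval_at j : #|[set i | j \in cyclic_interval i]| = e.
Proof.
have inj : injective (fun i => j - i)%R by move=> x y /addrI/oppr_inj.
rewrite -[RHS]card_ord_lt -[LHS](card_imset _ inj).
apply: eq_card => k; rewrite [RHS]inE; apply/imsetP/idP => [[i]|ltk].
  by rewrite !inE => lti ->.
by exists (j - k)%R; rewrite ?inE subKr.
Qed.

(** Double counting of the pairs [(i, j)] with [j] in [A] and in the interval at [i]. *)
Lemma sum_cap_cyclic_interval A : \sum_i #|A :&: cyclic_interval i| = #|A| * e.
Proof.
transitivity (\sum_i \sum_(j in A) (j \in cyclic_interval i : nat)).
  apply: eq_bigr => i _; rewrite -big_mkcondr /= -sum1_card.
  by apply: eq_bigl => j; rewrite inE.
rewrite exchange_big /= -sum_nat_const; apply: eq_bigr => j _.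
by rewrite -big_mkcond sum1dep_card card_cyclic_interval_at.
Qed.

(** Both totals over all [i] are equal, so the terms at [i != 0] cancel and leave those at [0]. *)
Lemma eq_cap_cyclic_interval A B :
    #|A| = #|B| ->
    (forall i, i != 0%R -> #|A :&: cyclic_interval i| = #|B :&: cyclic_interval i|) ->
  forall i, #|A :&: cyclic_interval i| = #|B :&: cyclic_interval i|.
Proof.
move=> eqAB eqI i; have [->|/eqI//] := eqVneq i 0%R.
have := sum_cap_cyclic_interval A; rewrite eqAB -sum_cap_cyclic_interval.
rewrite (bigD1 (0%R : 'I_m.+1)) //= [RHS](bigD1 (0%R : 'I_m.+1)) //=.
by rewrite [in RHS](eq_bigr _ (fun i Hi => esym (eqI i Hi))) => /addIn.
Qed.

Lemma card_capU1 A B i : i \notin B -> #|A :&: (i |: B)| = (i \in A) + #|A :&: B|.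
Proof.
move=> iB; rewrite (cardsD1 i) !inE eqxx andbT; congr (_ + _).
apply: eq_card => j; rewrite !inE; have [->|//] := eqVneq j i.
by rewrite (negPf iB) andbF.
Qed.

Let val_inZp k : k <= m -> (inZp k : 'I_m.+1) = k :> nat.
Proof. by move=> lekm; rewrite /= modn_small. Qed.

Lemma val_subZp1 i : (i - inZp 1)%R = (if i == 0%R then m else i.-1) :> nat.
Proof.
have m_gt0 : 0 < m by apply: leq_ltn_trans lt_em.
rewrite -val_eqE /= (@modn_small 1) // subn1 /= (@modn_small m) //.
case: i => -[|k] /= ltk; first by rewrite modn_small.
by rewrite addSnnS modnDr modn_small // ltnW.
Qed.

(** Both sides are the interval of length [e + 1] starting at [i], with its last or its first point
    split off. *)
Lemma cyclic_interval_shift i :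
  (i + inZp e)%R |: cyclic_interval i = i |: cyclic_interval (i + inZp 1)%R.
Proof.
apply/setP => j; rewrite !inE opprD addrA val_subZp1 subr_eq0.
have -> : (j == i + inZp e)%R = (nat_of_ord (j - i)%R == e).
  by rewrite addrC -subr_eq -(inj_eq val_inj) [X in _ == X]val_inZp // ltnW.
rewrite -leq_eqVlt.
(* The case [j = i] is apart because there [j - i - 1] wraps around to [m]. *)
have [->|ji] := eqVneq j i; first by rewrite subrr.
by rewrite -subr_eq0 -val_eqE /= in ji; rewrite /= prednK ?lt0n.
Qed.

Lemma cap_cyclic_interval_shift A i :
  ((i + inZp e)%R \in A) + #|A :&: cyclic_interval i| =
  (i \in A) + #|A :&: cyclic_interval (i + inZp 1)%R|.
Proof.
rewrite -!card_capU1 ?cyclic_interval_shift // inE.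
  (* The added points are new: [i + e] has offset [e] from [i], and [i] has offset [-1], that is
     [m], from [i + 1]. *)
  by rewrite addrAC subrr add0r val_inZp ?ltnn // ltnW.
by rewrite opprD addrA subrr val_subZp1 eqxx -leqNgt ltnW.
Qed.

End CyclicInterval.

Lemma cyclic_interval_separates e (A B : {set 'I_(2 * e).+1}) :
    0 < e -> #|A| = e -> #|B| = e ->
    (forall i, #|A :&: cyclic_interval e i| = #|B :&: cyclic_interval e i|) ->
  A = B.
Proof.
move=> e_gt0 cA cB eqI; apply/eqP; rewrite eqEcard cA cB leqnn andbT.
have lt_e2e : e < 2 * e by rewrite mul2n -addnn -addn1 leq_add2l.
apply/subsetPn => -[a aA aB].
have stepe i : i \in A :\: B -> (i + inZp e)%R \in A :\: B.
  rewrite !inE => /andP[iB iA].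
  have := cap_cyclic_interval_shift lt_e2e A i.
  have := cap_cyclic_interval_shift lt_e2e B i.
  rewrite !eqI iA (negPf iB) add0n => <-; rewrite addnA => /addIn.
  (* The membership bit of [i + e] in [A] is 1 plus that in [B], so they are 1 and 0. *)
  by do 2!case: (_ \in _).
have step1 i : i \in A :\: B -> (i - inZp 1)%R \in A :\: B.
  move=> /stepe/stepe; rewrite -addrA.
  (* Two translations by [e] amount to one by [-1], as [2e + 1 = 0]. *)
  suff -> : (inZp e + inZp e)%R = (- inZp 1)%R :> 'I_(2 * e).+1 by [].
  apply/eqP; rewrite -addr_eq0; apply/eqP/val_inj => /=.
  by rewrite modnDm (@modn_small e) 1?ltnW // addnn -mul2n addn1 modnn.
have all k : (a - inZp k)%R \in A :\: B.
  elim: k => [|k IH].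
    suff -> : inZp 0 = 0%R :> 'I_(2 * e).+1 by rewrite subr0 inE aB.
    by apply/val_inj; rewrite /= mod0n.
  suff -> : (a - inZp k.+1 = a - inZp k - inZp 1)%R by apply: step1.
  rewrite -addrA -opprD; congr (_ - _)%R.
  by apply/val_inj; rewrite /= modnDm addn1.
(* Any point [j] is [a - k] for [k = a - j], so [A] would contain all points, against [#|A| = e]. *)
suff : #|A| = (2 * e).+1.
  by rewrite cA => E; move: lt_e2e; rewrite {1}E ltnNge leqnSn.
rewrite -[RHS]card_ord; apply: eq_card => j.
have := all (val (a - j)%R); rewrite valZpK subKr inE => /andP[_ jA].
by rewrite jA.
Qed.

Lemma metric_dim_johnson_odd e : 0 < e -> metric_dim (@johnson (2 * e).+1 e) <= 2 * e.
Proof.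
move=> e_gt0.
have lt_e2e : e < 2 * e by rewrite mul2n -addnn -addn1 leq_add2l.
pose I (i : 'I_(2 * e).+1) : johnson_vertex (2 * e).+1 e :=
  Sub (cyclic_interval e i) (introT eqP (card_cyclic_interval lt_e2e i)).
pose S := I @: [set~ (0%R : 'I_(2 * e).+1)].
have rS : resolving (@johnson (2 * e).+1 e) S.
  apply/resolvingP => P Q neqPQ.
  apply/exists_inP; apply: contraNT neqPQ => /exists_inPn eqd.
  have [cP cQ] := (eqP (valP P), eqP (valP Q)).
  apply/eqP/val_inj/cyclic_interval_separates => //.
  apply: eq_cap_cyclic_interval => // [|i i0]; first by rewrite cP.
  apply: (@johnson_dist_cap _ _ P Q (I i)); apply/eqP; rewrite -[_ == _]negbK.
  by apply: eqd; apply: imset_f; rewrite !inE.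
have [_ /(_ S rS)] := metric_dimP (@johnson (2 * e).+1 e).
move/leq_trans; apply; apply: leq_trans (leq_imset_card _ _) _.
by rewrite cardsC1 card_ord.
Qed.

Theorem theorem2p2 (e : nat) (he : 3 <= e) :
  metric_dim (@johnson (2 * e + 1) e) <= 2 * e.
Proof. by rewrite addn1; apply/metric_dim_johnson_odd/ltnW/ltnW. Qed.
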